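(* Assume $\{Y^{k+1}_{n,m}\}$ is a solution of the spectral deferred correction (SDC) method defined by either the explicit update $$Y_{n,m+1}^{k+1} = Y_{n,m}^{k+1} + \Delta t_{n,m}\,\big[f(Y_{n,m}^{k+1}, t_{n,m}) - f(Y_{n,m}^k,t_{n,m})\big] + \int_{t_{n,m}}^{t_{n,m+1}} S_n f^k \,dt \qquad \text{(explicit)}$$ or the implicit update $$Y_{n,m+1}^{k+1} = Y_{n,m}^{k+1} + \Delta t_{n,m}\,\big[f(Y_{n,m+1}^{k+1}, t_{n,m+1}) - f(Y_{n,m+1}^k,t_{n,m+1})\big] + \int_{t_{n,m}}^{t_{n,m+1}} S_n f^k \,dt \qquad \text{(implicit)}$$ and $Y^{k+1}(t)$ is the finite element solution defined by: find $Y^{k+1}(t)\in\mathcal C^q$ such that $Y^{k+1}(0)=y_0$ and, for $n=0,\dots,N-1$ and $m=0,\dots,M-1$, $$\langle \dot Y^{k+1}, v\rangle_{I_{n,m}} = \langle f(Y^{k+1},t)-f(Y^k,t), v\rangle_{R,I_{n,m}} + \langle S_n f^k, v\rangle_{I_{n,m}}\qquad \text{for all } v\in\mathcal P^{q-1}(I_{n,m}),$$ for $R=LHR$ (left-hand rule) or $R=RHR$ (right-hand rule) respectively, i.e. $R=LHR$ for the explicit and $R=RHR$ for the implicit SDC method. Then $$Y^{k+1}(t_{n,m}) = Y^{k+1}_{n,m}\qquad\text{for all } n=0,\dots,N-1 \text{ and } m=0,\dots,M.$$ That is, the finite element method is nodally equivalent to the SDC method.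
   Context: The ODE is $\dot y(t)=f(y(t),t)$, $t\in(0,T]$, $y(0)=y_0\in\mathbb R^d$, with $f:\mathbb R^d\times\mathbb R\to\mathbb R^d$. Grid: $0=t_0<t_1<\dots<t_N=T$, $I_n=[t_n,t_{n+1}]$. Each $I_n$ is subdivided by $M+1$ subnodes $t_n=t_{n,0}<t_{n,1}<\dots<t_{n,M}=t_{n+1}$ (the Gauss-Lobatto nodes of $I_n$), with $I_{n,m}=[t_{n,m},t_{n,m+1}]$ and $\Delta t_{n,m}=t_{n,m+1}-t_{n,m}$. SDC values: $Y^k_{n,m}\in\mathbb R^d$ denotes the approximation of $y(t_{n,m})$ after $k$ iterations of the SDC method, $k\ge 0$. The updates are applied for $m=0,\dots,M-1$ on each interval $I_n$, $n=0,\dots,N-1$, in turn, starting from $Y^{k+1}_{0,0}=y_0$ and carrying values over between intervals by $Y^{k+1}_{n+1,0}=Y^{k+1}_{n,M}$. $S_n f^k$ is the ($\mathbb R^d$-valued) polynomial interpolant over $I_n$ of the $M+1$ values $f(Y^k_{n,m},t_{n,m})$ at the nodes $t_{n,m}$, $m=0,\dots,M$. Finite element iterates: the finite element method is defined iteratively, like the SDC method. The finite element solution $Y^k(t)\in\mathcal C^q$ at the $k$-th iteration, which represents the $k$-th SDC iterate in the sense that $Y^k(t_{n,m})=Y^k_{n,m}$, is assumed to have already been computed. Spaces: for $q\ge 1$, $\mathcal P^{q}(I_{n,m})$ is the space of ($\mathbb R^d$-valued) polynomials of degree at most $q$ on $I_{n,m}$, and $\mathcal C^q=\{w\in C^0([0,T];\mathbb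 R^d): w|_{I_{n,m}}\in\mathcal P^q(I_{n,m}),\ 0\le n\le N-1,\ 0\le m\le M-1\}$. Inner products: $(\cdot,\cdot)$ is the Euclidean inner product on $\mathbb R^d$ and $\langle g,v\rangle_{I_{n,m}}=\int_{I_{n,m}}(g,v)\,dt$. $\langle g,v\rangle_{R,I_{n,m}}$ is the approximation of this integral by a quadrature rule: $\langle g,v\rangle_{LHR,I_{n,m}}=\Delta t_{n,m}\,(g(t_{n,m}),v(t_{n,m}))$ and $\langle g,v\rangle_{RHR,I_{n,m}}=\Delta t_{n,m}\,(g(t_{n,m+1}),v(t_{n,m+1}))$. Nodal equivalence: two approximations are nodally equivalent if they are equal at the nodes $t_n$, $0\le n\le N$; two methods are nodally equivalent if they generate nodally equivalent approximations.
   Formalization: For the implicit method the formal theorem additionally assumes that the implicit SDC updates, with the given k-th iterate and y_0, have only one solution at the nodes; otherwise the SDC and finite element solutions may differ (e.g. f(z,t)=z with step 1 and matching data). *)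

(* Defs.v *)
(* MathComp / MathComp-Analysis, over an arbitrary [R : realType]. *)
From HB Require Import structures.
From mathcomp Require Import all_boot all_order all_algebra.
From mathcomp Require Import all_classical all_reals all_analysis.

Set Implicit Arguments.
Unset Strict Implicit.
Unset Printing Implicit Defensive.

Import Order.TTheory GRing.Theory Num.Theory.
Import numFieldNormedType.Exports.

Local Open Scope classical_set_scope.
Local Open Scope ring_scope.

Section Definitions.
Context {R : realType}.

(* Rodrigues' formula. *)
Definition legendre (M : nat) : {poly R} :=
  (2 ^+ M * M`!%:R)^-1 *: derivn M (('X^2 - 1) ^+ M).

(* s_0 < ... < s_M are the M+1 Gauss-Lobatto nodes of [a, b]: the two end
   points and, transported to [-1, 1], the zeros of the derivative of the
   Legendre polynomial of degree M. *)
Definition gauss_lobatto (M : nat) (a b : R) (s : nat -> R) : Prop :=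
  [/\ s 0%N = a, s M = b,
      forall m, (m < M)%N -> s m < s m.+1 &
      forall m, (0 < m < M)%N ->
        root (deriv (legendre M)) ((2 * s m - (a + b)) / (b - a))].

(* [tau n] is t_n and [t n m] is t_{n,m}. Node families are indexed by [nat];
   only n <= N (resp. n < N and m <= M) are meaningful. *)
Definition sdc_grid (T : R) (N M : nat) (tau : nat -> R) (t : nat -> nat -> R)
    : Prop :=
  [/\ tau 0%N = 0, tau N = T,
      forall n, (n < N)%N -> tau n < tau n.+1 &
      forall n, (n < N)%N -> gauss_lobatto M (tau n) (tau n.+1) (t n)].

Definition dt (t : nat -> nat -> R) (n m : nat) : R := t n m.+1 - t n m.

Definition lagrange_poly (M : nat) (s : nat -> R) (j : nat) : {poly R} :=
  \prod_(l < M.+1 | l != j :> nat) ((s j - s l)^-1 *: ('X - (s l)%:P)).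

Section Vectors.
Context {d : nat}.
Implicit Types (g v w : R -> 'rV[R]_d) (f : 'rV[R]_d -> R -> 'rV[R]_d).

Definition dot (x y : 'rV[R]_d) : R := \sum_(i < d) x 0 i * y 0 i.

Definition vderive w (s : R) : 'rV[R]_d :=
  \row_i derive1 (fun r => w r 0 i) s.

Definition vintegral (a b : R) g : 'rV[R]_d :=
  \row_i \int[lebesgue_measure]_(s in `[a, b]) g s 0 i.

Definition vpoly (q : nat) (a b : R) v : Prop :=
  exists p : 'I_d -> {poly R},
    (forall i, (size (p i) <= q.+1)%N) /\
    (forall s i, s \in `[a, b] -> v s 0 i = (p i).[s]).

Definition fe_space (q : nat) (T : R) (N M : nat) (t : nat -> nat -> R) w
    : Prop :=
  {within `[0, T], continuous w} /\
  (forall n m, (n < N)%N -> (m < M)%N -> vpoly q (t n m) (t n m.+1) w).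

(* The polynomial interpolant, of degree at most M, of the values [y m] at the
   nodes [s m], m = 0, ..., M, in Lagrange form. *)
Definition interpolant (M : nat) (s : nat -> R) (y : nat -> 'rV[R]_d)
    : R -> 'rV[R]_d :=
  fun r => \sum_(j < M.+1) (lagrange_poly M s j).[r] *: y j.

Definition interp_f f (M : nat) (t : nat -> nat -> R)
    (Y : nat -> nat -> 'rV[R]_d) (n : nat) : R -> 'rV[R]_d :=
  interpolant M (t n) (fun m => f (Y n m) (t n m)).

Definition explicit_update f M t (Yk Yk1 : nat -> nat -> 'rV[R]_d) n m : Prop :=
  Yk1 n m.+1 = Yk1 n m
    + dt t n m *: (f (Yk1 n m) (t n m) - f (Yk n m) (t n m))
    + vintegral (t n m) (t n m.+1) (interp_f f M t Yk n).

Definition implicit_update f M t (Yk Yk1 : nat -> nat -> 'rV[R]_d) n m : Prop :=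
  Yk1 n m.+1 = Yk1 n m
    + dt t n m *: (f (Yk1 n m.+1) (t n m.+1) - f (Yk n m.+1) (t n m.+1))
    + vintegral (t n m) (t n m.+1) (interp_f f M t Yk n).

Definition sdc_sweep (update : nat -> nat -> Prop) (y0 : 'rV[R]_d) (N M : nat)
    (Yk1 : nat -> nat -> 'rV[R]_d) : Prop :=
  [/\ Yk1 0%N 0%N = y0,
      forall n, (n.+1 < N)%N -> Yk1 n.+1 0%N = Yk1 n M &
      forall n m, (n < N)%N -> (m < M)%N -> update n m].

Definition sdc_explicit f y0 N M t Yk Yk1 : Prop :=
  sdc_sweep (explicit_update f M t Yk Yk1) y0 N M Yk1.

Definition sdc_implicit f y0 N M t Yk Yk1 : Prop :=
  sdc_sweep (implicit_update f M t Yk Yk1) y0 N M Yk1.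

(* The implicit updates determine the sweep: [Yk1] is the only solution. This
   fails for general [f], e.g. when z |-> z - dt t n m *: f z (t n m.+1) is not
   injective. *)
Definition sdc_implicit_unique f y0 N M t Yk Yk1 : Prop :=
  forall Z : nat -> nat -> 'rV[R]_d, sdc_implicit f y0 N M t Yk Z ->
  forall n m, (n < N)%N -> (m <= M)%N -> Z n m = Yk1 n m.

Definition inner_on (t : nat -> nat -> R) (n m : nat) g v : R :=
  \int[lebesgue_measure]_(s in `[t n m, t n m.+1]) dot (g s) (v s).

Variant quad_rule := LHR | RHR.

Definition quad_node (r : quad_rule) (t : nat -> nat -> R) (n m : nat) : R :=
  match r with LHR => t n m | RHR => t n m.+1 end.

Definition quad_on (r : quad_rule) (t : nat -> nat -> R) (n m : nat) g v : R :=
  dt t n m * dot (g (quad_node r t n m)) (v (quad_node r t n m)).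

(* [Yk] holds the nodal values of the k-th iterate, [wk] is the k-th finite
   element iterate and [w] the (k+1)-st one. At the two end points of a
   subinterval [vderive w] need not be the one-sided derivative; these points
   do not contribute to the integral. *)
Definition fem_solution (r : quad_rule) (q : nat) f (y0 : 'rV[R]_d) (T : R)
    (N M : nat) (t : nat -> nat -> R) (Yk : nat -> nat -> 'rV[R]_d) wk w
    : Prop :=
  [/\ fe_space q T N M t w, w 0 = y0 &
      forall n m, (n < N)%N -> (m < M)%N ->
      forall v, vpoly q.-1 (t n m) (t n m.+1) v ->
        inner_on t n m (vderive w) v =
        quad_on r t n m (fun s => f (w s) s - f (wk s) s) v
        + inner_on t n m (interp_f f M t Yk n) v].

End Vectors.
End Definitions.

Section InterpolantFacts.
Context {R : realType} {d : nat}.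

Lemma lagrange_polyE (M : nat) (s : nat -> R) (j k : nat) :
  (forall i l, (i <= M)%N -> (l <= M)%N -> s i = s l -> i = l) ->
  (j <= M)%N -> (k <= M)%N -> (lagrange_poly M s j).[s k] = (k == j)%:R.
Proof.
move=> inj jM kM; rewrite /lagrange_poly horner_prod.
have [->|kj] := eqVneq k j.
  rewrite big1// => l lj; rewrite !hornerE mulVf// subr_eq0.
  apply: contra lj => /eqP sjl; apply/eqP/esym.
  by apply: inj => //; rewrite -ltnS ltn_ord.
rewrite (bigD1 (Ordinal (kM : (k < M.+1)%N)))//=.
by rewrite !hornerE subrr mulr0 mul0r.
Qed.

Lemma interpolantE (M : nat) (s : nat -> R) (y : nat -> 'rV[R]_d) (k : nat) :
  (forall i l, (i <= M)%N -> (l <= M)%N -> s i = s l -> i = l) ->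
  (k <= M)%N -> interpolant M s y (s k) = y k.
Proof.
move=> inj kM; rewrite /interpolant.
rewrite (bigD1 (Ordinal (kM : (k < M.+1)%N)))//= lagrange_polyE// eqxx scale1r.
rewrite big1 ?addr0// => j jk; rewrite lagrange_polyE -1?ltnS ?ltn_ord//.
rewrite (_ : (k == j :> nat) = false) ?scale0r//.
by apply: contraNF jk => /eqP kj; apply/eqP/val_inj.
Qed.

Lemma size_lagrange_poly (M : nat) (s : nat -> R) (j : 'I_M.+1) :
  (size (lagrange_poly M s j) <= M.+1)%N.
Proof.
apply: (leq_trans (size_poly_prod_leq _ _)).
have cardM : #|[pred l : 'I_M.+1 | l != j :> nat]| = M.
  by rewrite (@eq_card _ _ (predC1 j))// cardC1 card_ord.
rewrite [X in (_ - X)%N]cardM leq_subLR addnS ltnS.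
have -> : (M + M = \sum_(l < M.+1 | l != j :> nat) 2)%N.
  by rewrite sum_nat_const [X in (X * _)%N]cardM muln2 addnn.
apply: leq_sum => l _; apply: (leq_trans (size_scale_leq _ _)).
by rewrite size_XsubC.
Qed.

Lemma vpoly_interpolant (M : nat) (s : nat -> R) (y : nat -> 'rV[R]_d)
  (a b : R) : vpoly M a b (interpolant M s y).
Proof.
exists (fun i => \sum_(j < M.+1) y j 0 i *: lagrange_poly M s j).
split=> [i|r i _].
  apply/(leq_trans (size_sum _ _ _))/bigmax_leqP => j _.
  exact: leq_trans (size_scale_leq _ _) (size_lagrange_poly _ _).
rewrite /interpolant summxE horner_sum; apply: eq_bigr => j _.
by rewrite mxE hornerE mulrC.
Qed.

End InterpolantFacts.

(* Main.v *)
(* Testing the finite element equation with the constant vectors e_i, which lie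
   in P^{q-1}, turns its left-hand side into the increment of Y^{k+1} over
   I_{n,m} and its right-hand side into the SDC increment. The nodal values of
   Y^{k+1} therefore satisfy the SDC recursion, whose solution is unique: by
   induction for the explicit method, by hypothesis for the implicit one. *)
Require Import Defs.
From HB Require Import structures.
From mathcomp Require Import all_boot all_order all_algebra.
From mathcomp Require Import all_classical all_reals all_analysis.

Import Order.TTheory GRing.Theory Num.Theory.
Import numFieldNormedType.Exports.

Local Open Scope classical_set_scope.
Local Open Scope ring_scope.

(** Differentiation is local, and near any interior point [g] coincides with [p]. The end points are
    excluded because the two-sided [derive1] there also sees values of [g] outside [[a, b]]. *)
Lemma derive1_eq_horner {R : realType} {g : R -> R} {p : {poly R}} {a b : R} :
  {in `[a, b], g =1 horner p} ->
  {in `]a, b[, derive1 g =1 horner (p^`())%R}.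
Proof.
move=> gp x xab; rewrite derivE !derive1E; apply: near_eq_derive.
near=> y; apply: gp; apply: subset_itv_oo_cc.
by near: y; exact: near_in_itvoo.
Unshelve. all: by end_near. Qed.

Lemma Rintegral_derive1_horner {R : realType} {g : R -> R}
    {p : {poly R}} {a b : R} :
  a < b ->
  {in `[a, b], g =1 horner p} ->
  \int[lebesgue_measure]_(s in `[a, b]) derive1 g s = g b - g a.
Proof.
move=> ab gp; have g'p := derive1_eq_horner gp.
have mp : measurable_fun `]a, b[ (horner (p^`())%R) by exact: measurable_poly.
(* The two integrands are known to agree only on the open interval, which suffices since the end
   points have measure zero. *)
rewrite /Rintegral (@eq_integral_itv_bounded _ _ _ (horner (p^`())%R))//;
  last first.
  by apply: eq_measurable_fun mp => x /[1!inE] xab; rewrite g'p.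
rewrite (@continuous_FTC2 _ _ (horner p))//.
- by rewrite -EFinD/= !gp// in_itv/= lexx ltW.
- by apply: continuous_subspaceT; exact: continuous_horner.
- split=> [x _||]; first exact: derivable_horner.
  + by apply: cvg_at_right_filter; exact: continuous_horner.
  + by apply: cvg_at_left_filter; exact: continuous_horner.
- by move=> x _; rewrite derivE.
Qed.

Lemma dot_delta {R : realType} {d : nat} (x : 'rV[R]_d) (i : 'I_d) :
  dot x (delta_mx 0 i) = x 0 i.
Proof.
rewrite /dot (bigD1 i)//= big1 ?addr0 => [|j ji].
  by rewrite mxE !eqxx mulr1.
by rewrite mxE eqxx (negbTE ji) mulr0.
Qed.

Lemma vpoly_cst {R : realType} {d q : nat} {a b : R} (x : 'rV[R]_d) :
  vpoly q a b (cst x).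
Proof.
exists (fun i => (x 0 i)%:P); split=> [i|s i _]; last by rewrite hornerC.
exact: leq_trans (size_polyC_leq1 _) _.
Qed.

(** On a constant test vector either rule reduces to [dt t n m] times the value at its single node
    [s], so one argument serves both methods. *)
Lemma fem_increment {R : realType} {r : quad_rule} {d q : nat}
    {f : 'rV[R]_d -> R -> 'rV[R]_d} {y0 : 'rV[R]_d} {T : R} {N M : nat}
    {t : nat -> nat -> R} {Yk : nat -> nat -> 'rV[R]_d} {wk w : R -> 'rV[R]_d}
    {n m : nat} :
  fem_solution r q f y0 T N M t Yk wk w ->
  (n < N)%N -> (m < M)%N -> t n m < t n m.+1 ->
  let s := quad_node r t n m in
  w (t n m.+1) = w (t n m) + dt t n m *: (f (w s) s - f (wk s) s)
    + vintegral (t n m) (t n m.+1) (interp_f f M t Yk n).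
Proof.
move=> [[_ wpoly] _ wfem] nN mM ltt s.
have [p [_ wp]] := wpoly n m nN mM.
apply/rowP => i; have := wfem n m nN mM _ (vpoly_cst (delta_mx 0 i)).
rewrite /inner_on /quad_on /cst/= dot_delta -/s.
under eq_Rintegral do rewrite dot_delta mxE.
under [X in _ = _ + X -> _]eq_Rintegral do rewrite dot_delta.
rewrite (@Rintegral_derive1_horner _ _ (p i) _ _)//; last first.
  by move=> x xab /=; exact: wp.
(* The tested equation, read from right to left, replaces the quadrature term plus the integral by
   the increment of [w]. *)
by rewrite !mxE -addrA => <-; rewrite addrC subrK.
Qed.

Lemma sdc_grid_lt {R : realType} {T : R} {N M : nat} {tau : nat -> R}
    {t : nat -> nat -> R} {n m : nat} :
  sdc_grid T N M tau t -> (n < N)%N -> (m < M)%N -> t n m < t n m.+1.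
Proof. by move=> [_ _ _ gl] nN mM; have [_ _ + _] := gl n nN; exact. Qed.

(** Only the updates depend on the rule. Carrying over is automatic: [t n M] and [t n.+1 0] are both
    [tau n.+1], where [w] has a single value. *)
Lemma fem_nodal_sweep {R : realType} {r : quad_rule} {d q : nat}
    {f : 'rV[R]_d -> R -> 'rV[R]_d} {y0 : 'rV[R]_d} {T : R} {N M : nat}
    {tau : nat -> R} {t : nat -> nat -> R} {Yk : nat -> nat -> 'rV[R]_d}
    {wk w : R -> 'rV[R]_d} {update : nat -> nat -> Prop} :
  (0 < N)%N -> sdc_grid T N M tau t ->
  fem_solution r q f y0 T N M t Yk wk w ->
  (forall n m, (n < N)%N -> (m < M)%N -> update n m) ->
  sdc_sweep update y0 N M (fun n m => w (t n m)).
Proof.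
move=> N0 [tau0 _ _ gl] [_ w0 _] upd; split=> // [|n nN].
  (* Since [0 < N], interval 0 belongs to the grid, which forces its first node to be 0. *)
  by have [-> _ _ _] := gl _ N0; rewrite tau0.
have [-> _ _ _] := gl _ nN.
by have [_ -> _ _] := gl n (ltnW nN).
Qed.

Lemma fem_sdc_explicit {R : realType} {d q : nat}
    {f : 'rV[R]_d -> R -> 'rV[R]_d} {y0 : 'rV[R]_d} {T : R} {N M : nat}
    {tau : nat -> R} {t : nat -> nat -> R} {Yk : nat -> nat -> 'rV[R]_d}
    {wk w : R -> 'rV[R]_d} :
  (0 < N)%N -> sdc_grid T N M tau t ->
  (forall n m, (n < N)%N -> (m <= M)%N -> wk (t n m) = Yk n m) ->
  fem_solution LHR q f y0 T N M t Yk wk w ->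
  sdc_explicit f y0 N M t Yk (fun n m => w (t n m)).
Proof.
move=> N0 grid wkY fem; apply: (fem_nodal_sweep N0 grid fem) => n m nN mM.
(* The sweep reads the k-th iterate from [Yk], the quadrature from [wk]; the two agree at the
   quadrature node. *)
rewrite /explicit_update -wkY ?(ltnW mM)//.
exact: (fem_increment fem nN mM (sdc_grid_lt grid nN mM)).
Qed.

Lemma fem_sdc_implicit {R : realType} {d q : nat}
    {f : 'rV[R]_d -> R -> 'rV[R]_d} {y0 : 'rV[R]_d} {T : R} {N M : nat}
    {tau : nat -> R} {t : nat -> nat -> R} {Yk : nat -> nat -> 'rV[R]_d}
    {wk w : R -> 'rV[R]_d} :
  (0 < N)%N -> sdc_grid T N M tau t ->
  (forall n m, (n < N)%N -> (m <= M)%N -> wk (t n m) = Yk n m) ->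
  fem_solution RHR q f y0 T N M t Yk wk w ->
  sdc_implicit f y0 N M t Yk (fun n m => w (t n m)).
Proof.
move=> N0 grid wkY fem; apply: (fem_nodal_sweep N0 grid fem) => n m nN mM.
rewrite /implicit_update -wkY//.
exact: (fem_increment fem nN mM (sdc_grid_lt grid nN mM)).
Qed.

(** Besides the fixed data [Yk], each explicit update uses only the value at the preceding node, so
    the values are determined one after another. *)
Lemma sdc_explicit_unique {R : realType} {d : nat}
    {f : 'rV[R]_d -> R -> 'rV[R]_d} {y0 : 'rV[R]_d} {N M : nat}
    {t : nat -> nat -> R} {Yk Z1 Z2 : nat -> nat -> 'rV[R]_d} :
  sdc_explicit f y0 N M t Yk Z1 -> sdc_explicit f y0 N M t Yk Z2 ->
  forall n m, (n < N)%N -> (m <= M)%N -> Z1 n m = Z2 n m.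
Proof.
move=> [Z10 Z1c Z1u] [Z20 Z2c Z2u].
have within_interval n : (n < N)%N -> Z1 n 0%N = Z2 n 0%N ->
    forall m, (m <= M)%N -> Z1 n m = Z2 n m.
  move=> nN Z0; elim=> [//|m ih mM].
  by rewrite (Z1u n m nN mM) (Z2u n m nN mM) ih// ltnW.
(* The induction hypothesis ranges over all nodes of interval [n]; it is used at node [M], whose
   value is carried over. *)
elim=> [|n ih] m nN; apply: within_interval => //; first by rewrite Z10.
by rewrite Z1c// Z2c// ih// ltnW.
Qed.

Theorem theorem1 (R : realType) (d N M q k : nat) (T : R)
    (f : 'rV[R]_d -> R -> 'rV[R]_d) (y0 : 'rV[R]_d)
    (tau : nat -> R) (t : nat -> nat -> R)
    (Y : nat -> nat -> nat -> 'rV[R]_d) (* Y k n m = Y^k_{n,m} *)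
    (w : nat -> R -> 'rV[R]_d)          (* w k s = Y^k(s) *) :
  (0 < d)%N -> (0 < N)%N -> (0 < M)%N -> (1 <= q)%N ->
  sdc_grid T N M tau t ->
  fe_space q T N M t (w k) ->
  (forall n m, (n < N)%N -> (m <= M)%N -> w k (t n m) = Y k n m) ->
  (sdc_explicit f y0 N M t (Y k) (Y k.+1) /\
   fem_solution LHR q f y0 T N M t (Y k) (w k) (w k.+1)) \/
  (sdc_implicit f y0 N M t (Y k) (Y k.+1) /\
   sdc_implicit_unique f y0 N M t (Y k) (Y k.+1) /\
   fem_solution RHR q f y0 T N M t (Y k) (w k) (w k.+1)) ->
  forall n m, (n < N)%N -> (m <= M)%N -> w k.+1 (t n m) = Y k.+1 n m.
Proof.
move=> _ N0 _ _ grid _ wY [[sdcY fem]|[_ [uniqY fem]]].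
- exact: sdc_explicit_unique (fem_sdc_explicit N0 grid wY fem) sdcY.
(* The competing solution [Z] is the family of nodal values of [w k.+1]. *)
- exact: uniqY (fem_sdc_implicit N0 grid wY fem).
Qed.
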